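(* Let $p=f+h$ and $$q=-\frac{(h^3+h^2)^2}{f^2}-\frac{2h^2(h^3+h^2)}{f}+4h^3+\frac{3h^2}{2}-5hf .$$ Then the map $(p,q):\mathbb{R}^2\to\mathbb{R}^2$ is a non-injective polynomial local diffeomorphism. The degree of $p$ is $10$ and the degree of $q$ is $15$.
   Context: Let $t,h,f\in\mathbb{R}[x,y]$ be the polynomials $$t=xy-1,\qquad h=xt^2+t,\qquad f=(xt+1)^2(t^2+y).$$ As polynomials, $h^3+h^2=f\,(h-t)$, and the expression $\frac{h^3+h^2}{f}$ denotes the polynomial $h-t$ (also at points where $f=0$), so $q$ is a polynomial in $(x,y)$. Degree means total degree in $(x,y)$. A polynomial local diffeomorphism of $\mathbb{R}^2$ is a polynomial map $\mathbb{R}^2\to\mathbb{R}^2$ that is a local diffeomorphism at every point, equivalently whose Jacobian determinant vanishes nowhere on $\mathbb{R}^2$. *)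

(* Defs.v *)
From mathcomp Require Import all_boot all_order all_algebra.
From mathcomp Require Export boolp classical_sets functions reals topology.
From mathcomp Require Export normedtype derive.
From mathcomp Require Export -(notations) mpoly.
From mathcomp Require Import ring.

Set Implicit Arguments.
Unset Strict Implicit.
Unset Printing Implicit Defensive.

Import Order.TTheory GRing.Theory Num.Theory.
Export numFieldNormedType.Exports.

Local Open Scope classical_set_scope.
Local Open Scope ring_scope.

(* For an open set [U] of a finite-dimensional space: [f] is of class C^k on
   [U].  In the successor case [f] is (Frechet) differentiable on [U] and each
   of its directional derivatives is of class C^(k-1) on [U]. *)
Fixpoint class_C (R : realType) (V W : normedModType R)
    (k : nat) (U : set V) (f : V -> W) {struct k} : Prop :=
  if k is k'.+1 then
    (forall x, U x -> differentiable f x) /\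
    (forall v : V, class_C k' U (fun x => 'D_v f x))
  else forall x, U x -> {for x, continuous f}.

Definition smooth_on (R : realType) (V W : normedModType R)
    (U : set V) (f : V -> W) : Prop :=
  forall k : nat, class_C k U f.

Definition local_diffeo_at (R : realType) (V W : normedModType R)
    (f : V -> W) (a : V) : Prop :=
  exists (A : set V) (B : set W) (g : W -> V),
    [/\ open A, A a, open B, set_bij A B f & forall x, A x -> g (f x) = x] /\
    smooth_on A f /\ smooth_on B g.

Definition local_diffeo (R : realType) (V W : normedModType R)
    (f : V -> W) : Prop :=
  forall a : V, local_diffeo_at f a.

(* [mpoly.msize P] is one plus the total degree of a nonzero [P]. *)
Definition total_degree (R : realType) (P : mpoly 2 R) : nat :=
  (mpoly.msize P).-1.

Definition poly_map (R : realType) (P Q : mpoly 2 R) (z : R * R) : R * R :=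
  let v := tnth [tuple z.1; z.2] in (meval v P, meval v Q).

Section Polynomials.
Variable R : realType.

Definition x_poly : mpoly 2 R := mpolyX R (mnm1 ord0).
Definition y_poly : mpoly 2 R := mpolyX R (mnm1 ord_max).
Definition t_poly : mpoly 2 R := x_poly * y_poly - 1.
Definition h_poly : mpoly 2 R := x_poly * t_poly ^+ 2 + t_poly.
Definition f_poly : mpoly 2 R :=
  (x_poly * t_poly + 1) ^+ 2 * (t_poly ^+ 2 + y_poly).

(* The polynomial denoted by (h^3 + h^2) / f; see [hf_quotientE]. *)
Definition hf_quotient : mpoly 2 R := h_poly - t_poly.

Lemma hf_quotientE : h_poly ^+ 3 + h_poly ^+ 2 = f_poly * hf_quotient.
Proof. rewrite /hf_quotient /f_poly /h_poly /t_poly; ring. Qed.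

Definition p_poly : mpoly 2 R := f_poly + h_poly.
Definition q_poly : mpoly 2 R :=
  - (hf_quotient ^+ 2) - 2%:R * h_poly ^+ 2 * hf_quotient
  + 4%:R * h_poly ^+ 3 + mpolyC 2 (3%:R / 2%:R : R) * h_poly ^+ 2
  - 5%:R * h_poly * f_poly.

End Polynomials.

(* Main.v *)
Require Import Defs.
From HB Require Import structures.
From mathcomp Require Import all_boot all_order all_algebra.
From mathcomp Require Import prodnormedzmodule landau.
From mathcomp Require Import ring lra zify.

(** The theorem has three independent parts.

    Local invertibility.  Put [s = h - t], so that [f * s = h ^+ 3 + h ^+ 2].
    The Jacobian determinants of the pairs among [f], [h] and [s] are
    polynomials in [f], [h] and [s], hence so is that of [p] and [q], which are
    built from these three; it turns out to be the sum of squares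
    [2 * (s - f + h + 2 * h ^+ 2) ^+ 2 + 2 * (h + h ^+ 2 - f) ^+ 2 + f ^+ 2]
    ([jac_det_pq]), and the three squares have no common zero
    ([jac_det_pq_neq0]).  The smooth inverse function theorem for polynomial
    maps of the plane ([poly_map_local_diffeo_at]) concludes.

    That theorem rests on an algebraic substitute for the mean value
    inequality: a polynomial satisfies
    [P z - P w = A (z, w) * (z.1 - w.1) + B (z, w) * (z.2 - w.2)] with
    continuous slopes [A] and [B] that restrict to the partial derivatives on
    the diagonal ([exists_slopes]).  Near a point where the Jacobian
    determinant is nonzero, the map composed with a linear one is therefore a
    small perturbation of the identity ([poly_map_near_id]), and such
    perturbations are injective, with a Lipschitz inverse
    ([near_id_expanding]), and open ([open_image_near_id]).  The slopes also
    show that the inverse [g] is differentiable ([is_diff_inverse]).  For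
    smoothness, the derivatives of the components of [g] are polynomials in
    these components and in [1 / J \o g], where [J] is the Jacobian
    determinant; the algebra generated by these functions is closed under
    directional derivatives, so that all its members are smooth
    ([smooth_on_generated_pair], [smooth_inverse]).

    Non-injectivity.  On the curve [x * t + 1 = 0] both [f] and [h] vanish, so
    [p = 0] and [q = - t ^+ 2 = - 1 / x ^+ 2] there.  The points of this curve
    with [x = 1] and [x = -1] thus have the same image.

    Degrees.  The top terms of [t], [h], [s] and [f] are monomials, which
    multiply.  The top term of [p] is that of [f]; the terms of degree 15 in
    [q] come from [- 2 * h ^+ 2 * s], [4 * h ^+ 3] and [- 5 * h * f], all of
    them multiples of [x ^+ 9 * y ^+ 6], with sum
    [(- 2 + 4 - 5) * x ^+ 9 * y ^+ 6]. *)

Set Implicit Arguments.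
Unset Strict Implicit.
Unset Printing Implicit Defensive.

Import Order.TTheory GRing.Theory Num.Theory.

Local Open Scope classical_set_scope.
Local Open Scope ring_scope.

(** * Smoothness from algebras closed under derivatives *)

Section Differentiability.
Variables (R : realType) (V W : normedModType R).

Lemma is_diff_epsilon (f : V -> W) x (L : {linear V -> W}) : continuous L ->
  (forall e, 0 < e ->
     \forall h \near (0 : V), `|f (h + x) - (f x + L h)| <= e * `|h|) ->
  is_diff x f L.
Proof.
move=> cL small.
have o : f \o shift x = cst (f x) + L +o_ (0 : V) id.
  by apply/eqaddoP => e e0; exact: small.
have dE := diff_unique cL o.
by apply: DiffDef => //; apply/diff_locallyP; rewrite dE.
Qed.

Lemma near_eq_differentiable (f g : V -> W) x :
  (\forall y \near x, f y = g y) -> differentiable f x -> differentiable g x.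
Proof.
move=> fg df; have fgx := nbhs_singleton fg.
apply: (@ex_diff _ _ _ _ _ _ _ (@is_diff_epsilon g x ('d f x) _ _)) => [|e e0].
  exact: diff_continuous.
have /eqaddoP/(_ _ e0) := diff_locally df.
move: fg; rewrite (near_shift 0) /= subr0 => fg'.
by apply: filterS2 fg' => h /= <-; rewrite -fgx.
Qed.

End Differentiability.

Section Smoothness.
Variables (R : realType) (V : normedModType R) (U : set V).
Hypothesis openU : open U.

Lemma near_open (P : V -> Prop) x : U x -> (forall y, U y -> P y) ->
  \forall y \near x, P y.
Proof. by move=> Ux UP; apply: filterS UP _; exact: open_nbhs_nbhs. Qed.

Lemma class_C_ext (W : normedModType R) k (f g : V -> W) :
  (forall x, U x -> f x = g x) -> class_C k U f -> class_C k U g.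
Proof.
elim: k f g => [|k IH] f g fg /=.
  move=> fc x Ux; have fgx : \forall y \near x, f y = g y by exact: near_open.
  have c : f y @[y --> x] --> f x := fc x Ux.
  rewrite (fg x Ux) in c; apply: cvg_trans c.
  exact: near_eq_cvg.
move=> [df Df]; split=> [x Ux|v].
  by apply: near_eq_differentiable (df _ Ux); exact: near_open.
apply: IH (Df v) => x Ux.
by apply: near_eq_derive; exact: near_open.
Qed.

(** Families of functions avoid computing higher derivatives: the order [k] of
    differentiability drops by one at each derivative, which stays in the
    family. *)
Lemma smooth_on_family (W : normedModType R) (F : set (V -> W)) :
    (forall f, F f -> forall x, U x -> differentiable f x) ->
    (forall f, F f -> forall v,
       exists2 g, F g & forall x, U x -> 'D_v f x = g x) ->
  forall f, F f -> smooth_on U f.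
Proof.
move=> Fdiff FD f Ff k; elim: k f Ff => [|k IH] f Ff /=.
  by move=> x Ux; apply: differentiable_continuous; exact: Fdiff.
split=> [|v]; first exact: Fdiff.
have [g Fg fg] := FD _ Ff v.
by apply: class_C_ext (IH _ Fg) => x Ux; rewrite fg.
Qed.

(** The real algebra generated by [S]; as an inductive predicate it lets
    differentiability and the Leibniz rule propagate by structural induction. *)
Inductive generated (S : set (V -> R)) : set (V -> R) :=
| generated_gen g : S g -> generated S g
| generated_cst c : generated S (cst c)
| generatedD f g : generated S f -> generated S g -> generated S (f + g)
| generatedM f g : generated S f -> generated S g -> generated S (f * g).

Section Generated.
Variable S : set (V -> R).
Hypothesis S_diff : forall g, S g -> forall x, U x -> differentiable g x.
Hypothesis S_derive : forall g, S g -> forall v,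
  exists2 f, generated S f & forall x, U x -> 'D_v g x = f x.

Lemma generated_differentiable f :
  generated S f -> forall x, U x -> differentiable f x.
Proof.
elim=> [g|c|{}f g _ df _ dg|{}f g _ df _ dg] x Ux.
- exact: S_diff.
- exact: differentiable_cst.
- by apply: differentiableD; [exact: df|exact: dg].
- by apply: differentiableM; [exact: df|exact: dg].
Qed.

Lemma generated_derive f : generated S f -> forall v,
  exists2 g, generated S g & forall x, U x -> 'D_v f x = g x.
Proof.
have der g v x : generated S g -> U x -> derivable g x v.
  by move=> Sg Ux; apply: diff_derivable; exact: (generated_differentiable Sg).
elim=> [g Sg|c|{}f g Sf IHf Sg IHg|{}f g Sf IHf Sg IHg] v.
- exact: S_derive.
- by exists (cst 0); [exact: generated_cst|move=> x _; rewrite derive_cst].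
- have [[f' Sf' ff'] [g' Sg' gg']] := (IHf v, IHg v).
  exists (f' + g'); first exact: generatedD.
  by move=> x Ux; rewrite deriveD ?ff' ?gg' //; exact: der.
- have [[f' Sf' ff'] [g' Sg' gg']] := (IHf v, IHg v).
  exists (f * g' + g * f'); first by apply: generatedD; exact: generatedM.
  by move=> x Ux; rewrite deriveM ?ff' ?gg' //; exact: der.
Qed.

(** By the Leibniz rule the algebra is closed under directional derivatives as
    soon as the derivatives of its generators belong to it. *)
Lemma smooth_on_generated_pair f g : generated S f -> generated S g ->
  smooth_on U (fun x => (f x, g x)).
Proof.
move=> Sf Sg.
pose F := [set h : V -> R * R | exists u v,
  [/\ generated S u, generated S v & h = fun x => (u x, v x)]].
apply: (@smooth_on_family _ F); last by exists f, g.
  move=> _ [u [w [Su Sw ->]]] x Ux.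
  by apply: differentiable_pair; exact: generated_differentiable.
move=> _ [u [w [Su Sw ->]]] v.
have [u' Su' uu'] := generated_derive Su v.
have [w' Sw' ww'] := generated_derive Sw v.
exists (fun x => (u' x, w' x)); first by exists u', w'.
move=> x Ux; have du := generated_differentiable Su Ux.
have dw := generated_differentiable Sw Ux.
rewrite deriveE ?diff_pair //= -?deriveE ?uu' ?ww' //.
exact: differentiable_pair.
Qed.

End Generated.

End Smoothness.

(** * Polynomial functions on the plane and their slopes *)

Section Polynomials.
Variable R : realType.

Lemma mpoly_ring_ind n (K : mpoly n R -> Prop) :
    (forall c, K (mpolyC n c)) -> (forall i, K (mpolyX R (mnm1 i))) ->
    (forall P Q, K P -> K Q -> K (P + Q)) ->
    (forall P Q, K P -> K Q -> K (P * Q)) ->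
  forall P, K P.
Proof.
move=> KC KX KD KM; apply: mpolyind => [|c m P _ _ KP].
  by rewrite -(mpolyC0 n R).
apply: (KD) => //; rewrite -mul_mpolyC; apply: (KM) => //.
rewrite mpolyXE_id; apply: big_ind => [|P' Q'|i _].
- by rewrite -(mpolyC1 n R).
- exact: KM.
- elim: (m i) => [|k IH]; first by rewrite expr0 -(mpolyC1 n R).
  by rewrite exprS; exact: KM.
Qed.

Lemma mderiv_mpolyXU n (i j : 'I_n) :
  mderiv i (mpolyX R (mnm1 j)) = (i == j)%:R.
Proof.
rewrite mderivX mnm1E eq_sym; case: eqP => [->|_]; last by rewrite scale0r.
rewrite scale1r -[RHS](mpolyX0 n R); congr mpolyX.
by apply/mnmP => k; rewrite mnmBE mnm0E subnn.
Qed.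

Definition jac_det (P Q : mpoly 2 R) : mpoly 2 R :=
  mderiv ord0 P * mderiv ord_max Q - mderiv ord_max P * mderiv ord0 Q.

Definition peval (P : mpoly 2 R) (z : R * R) : R :=
  meval (tnth [tuple z.1; z.2]) P.

Lemma pevalC c z : peval (mpolyC 2 c) z = c.
Proof. exact: mevalC. Qed.

Lemma pevalX i z : peval (mpolyX R (mnm1 i)) z = tnth [tuple z.1; z.2] i.
Proof. exact: mevalXU. Qed.

Lemma pevalD P Q z : peval (P + Q) z = peval P z + peval Q z.
Proof. exact: mevalD. Qed.

Lemma pevalM P Q z : peval (P * Q) z = peval P z * peval Q z.
Proof. exact: mevalM. Qed.

Lemma peval_jac_det P Q z : peval (jac_det P Q) z =
  peval (mderiv ord0 P) z * peval (mderiv ord_max Q) z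
  - peval (mderiv ord_max P) z * peval (mderiv ord0 Q) z.
Proof. by rewrite /peval mevalB !mevalM. Qed.

Lemma continuous_peval P : continuous (peval P).
Proof.
elim/mpoly_ring_ind: P => [c|i|P Q cP cQ|P Q cP cQ] z.
- rewrite (_ : peval _ = cst c); first exact: cvg_cst.
  by apply/funext => w; rewrite pevalC.
- case: i => [[|[|//]] /= lt_i].
  + rewrite (_ : peval _ = fst); first exact: cvg_fst.
    by apply/funext => w; rewrite pevalX.
  + rewrite (_ : peval _ = snd); first exact: cvg_snd.
    by apply/funext => w; rewrite pevalX.
- rewrite (_ : peval _ = peval P + peval Q); first exact: cvgD (cP z) (cQ z).
  by apply/funext => w; rewrite pevalD.
- rewrite (_ : peval _ = peval P * peval Q); first exact: cvgM (cP z) (cQ z).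
  by apply/funext => w; rewrite pevalM.
Qed.

(** Joint continuity in both points is what makes the two uses of slopes work:
    uniform estimates over pairs of points near a given one, and
    differentiability in one point when the other one is fixed. *)
Definition slopes (P : mpoly 2 R) (A B : (R * R) * (R * R) -> R) :=
  [/\ continuous A, continuous B,
      forall z w, peval P z - peval P w =
        A (z, w) * (z.1 - w.1) + B (z, w) * (z.2 - w.2),
      forall z, A (z, z) = peval (mderiv ord0 P) z
    & forall z, B (z, z) = peval (mderiv ord_max P) z].

(** A difference of products splits as
    [P z * Q z - P w * Q w = (P z - P w) * Q z + P w * (Q z - Q w)]. *)
Lemma exists_slopes P : exists A B, slopes P A B.
Proof.
elim/mpoly_ring_ind: P => [c|i|P Q|P Q].
- exists (cst 0), (cst 0); split=> [z|z|z w|z|z]; try exact: cvg_cst.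
  + by rewrite !pevalC subrr !mul0r addr0.
  + by rewrite mderivC -(mpolyC0 2 R) pevalC.
  + by rewrite mderivC -(mpolyC0 2 R) pevalC.
- exists (cst (i == ord0)%:R), (cst (i == ord_max)%:R).
  split=> [z|z|z w|z|z]; try exact: cvg_cst.
  + rewrite !pevalX; case: i => [[|[|//]] lt_i];
      by rewrite !(tnth_nth 0) /= ?(mul1r, mul0r, addr0, add0r).
  + by rewrite mderiv_mpolyXU eq_sym -mpolyC_nat pevalC.
  + by rewrite mderiv_mpolyXU eq_sym -mpolyC_nat pevalC.
- move=> [A [B [cA cB AB dA dB]]] [A' [B' [cA' cB' AB' dA' dB']]].
  exists (fun zw => A zw + A' zw), (fun zw => B zw + B' zw).
  split=> [z|z|z w|z|z].
  + exact: cvgD (cA z) (cA' z).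
  + exact: cvgD (cB z) (cB' z).
  + have {}AB := AB z w; have {}AB' := AB' z w.
    by rewrite !pevalD opprD addrACA AB AB' /=; ring.
  + by rewrite mderivD pevalD -dA -dA'.
  + by rewrite mderivD pevalD -dB -dB'.
- move=> [A [B [cA cB AB dA dB]]] [A' [B' [cA' cB' AB' dA' dB']]].
  have c1 : continuous (fun zw : (R * R) * (R * R) => peval Q zw.1).
    by move=> z; apply: (continuous_comp (f := fst)) => //;
      [exact: cvg_fst|exact: continuous_peval].
  have c2 : continuous (fun zw : (R * R) * (R * R) => peval P zw.2).
    by move=> z; apply: (continuous_comp (f := snd)) => //;
      [exact: cvg_snd|exact: continuous_peval].
  exists (fun zw => A zw * peval Q zw.1 + peval P zw.2 * A' zw).
  exists (fun zw => B zw * peval Q zw.1 + peval P zw.2 * B' zw).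
  split=> [z|z|z w|z|z].
  + exact: cvgD (cvgM (cA z) (c1 z)) (cvgM (c2 z) (cA' z)).
  + exact: cvgD (cvgM (cB z) (c1 z)) (cvgM (c2 z) (cB' z)).
  + have {}AB := AB z w; have {}AB' := AB' z w; rewrite !pevalM /=.
    transitivity ((peval P z - peval P w) * peval Q z +
                  peval P w * (peval Q z - peval Q w)); first by ring.
    by rewrite AB AB'; ring.
  + by rewrite mderivM pevalD !pevalM /= -dA -dA'.
  + by rewrite mderivM pevalD !pevalM /= -dB -dB'.
Qed.

End Polynomials.

(** * Perturbations of the identity of the plane *)

Section NearIdentity.
Variable R : realType.
Implicit Types (A : set (R * R)) (z w : R * R).

Lemma prod_norm_le z (e : R) : (`|z| <= e) = (`|z.1| <= e) && (`|z.2| <= e).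
Proof. by rewrite prod_normE /= ge_max. Qed.

Lemma compact_box z (r : R) : compact [set w : R * R | `|w - z| <= r].
Proof.
have -> : [set w : R * R | `|w - z| <= r] =
    `[z.1 - r, z.1 + r] `*` `[z.2 - r, z.2 + r].
  apply/seteqP; split=> w /=; rewrite prod_norm_le !in_itv /= !ler_distl.
    by move=> /andP[].
  by move=> [-> ->].
by apply: compact_setX; exact: segment_compact.
Qed.

Lemma near_id_expanding A (f : R * R -> R * R) :
    (forall z w, A z -> A w -> `|f z - f w - (z - w)| <= `|z - w| / 2%:R) ->
  forall z w, A z -> A w -> `|z - w| <= 2%:R * `|f z - f w|.
Proof.
move=> near_id z w Az Aw; have := near_id _ _ Az Aw.
have := ler_normB (f z - f w) (f z - f w - (z - w)).
rewrite subKr; lra.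
Qed.

(** A point [w] near [f z0] is reached by minimizing [`|f z - w|] over a closed
    box around [z0]. Were the minimum [`|e|], with [e = f z - w], positive, the
    Newton-like step from [z] to [z - e] would at least halve it, so it only
    remains to see that this step does not leave the box. *)
Lemma open_image_near_id A (f : R * R -> R * R) : open A ->
    (forall z w, A z -> A w -> `|f z - f w - (z - w)| <= `|z - w| / 2%:R) ->
    (forall z, A z -> {for z, continuous f}) ->
  open (f @` A).
Proof.
move=> oA near_id cf; have expand := near_id_expanding near_id.
rewrite openE => _ [z0 Az0 <-].
have [r /= r0 ballA] : exists2 r, 0 < r & forall w, `|w - z0| < r -> A w.
  have /nbhs_ballP[r r0 rA] : nbhs z0 A by exact: open_nbhs_nbhs.
  exists r => // w wr; apply: rA.
  by rewrite -ball_normE /ball_ /= distrC.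
pose K := [set w : R * R | `|w - z0| <= r / 2%:R].
have KA w : K w -> A w by rewrite /K /= => Kw; apply: ballA; lra.
have Kz0 : K z0 by rewrite /K /= subrr normr0; lra.
(* the minimizer is within r / 4 of z0 and the step is shorter than r / 16,
   inside the box of radius r / 2 *)
apply/nbhs_ballP; exists (r / 16%:R) => [|w] /=; first lra.
rewrite -ball_normE /ball_ /= => wz0.
have K0 : K !=set0 by exists z0.
have cont : {within K, continuous (fun z => `|f z - w|)}.
  apply: continuous_in_subspaceT => z /set_mem /KA /cf cfz.
  apply: (continuous_comp (f := fun z => f z - w)); last exact: norm_continuous.
  by apply: cvgB; [exact: cfz|exact: cvg_cst].
have [z zK zmin] := compact_EVT_min K0 (@compact_box z0 (r / 2%:R)) cont.
have Az := KA _ (set_mem zK).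
exists z => //; apply/eqP; rewrite -subr_eq0 -normr_eq0.
set e := f z - w.
have ez0 : `|e| < r / 16%:R by apply: le_lt_trans wz0; exact/zmin/mem_set.
have zz0 : `|z - z0| < r / 4%:R.
  have := expand _ _ Az Az0; have := ler_normB e (f z0 - w).
  rewrite /e opprB addrA subrK; lra.
have Kze : K (z - e).
  have := ler_normB (z - z0) e; rewrite /K /= addrAC; lra.
have : `|f (z - e) - w| <= `|e| / 2%:R.
  have := near_id _ _ (KA _ Kze) Az.
  have -> : z - e - z = - e by rewrite addrAC subrr sub0r.
  rewrite opprK normrN; set u := f (z - e).
  by have -> : u - w = u - f z + e by rewrite /e addrA subrK.
have /zmin : z - e \in K by exact: mem_set.
have := normr_ge0 e; rewrite -/e; lra.
Qed.

End NearIdentity.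

(** * Derivatives and continuity of composites *)

(** This is Caratheodory's form of differentiability: the error of the linear
    approximation is [(a y - a x) * (y.1 - x.1) + (b y - b x) * (y.2 - x.2)],
    with both first factors tending to 0. *)
Lemma is_diff_slopes (R : realType) (f a b : R * R -> R) (x : R * R) :
    (\forall y \near x, f y - f x = a y * (y.1 - x.1) + b y * (y.2 - x.2)) ->
    {for x, continuous a} -> {for x, continuous b} ->
  is_diff x f (fun v => a x * v.1 + b x * v.2).
Proof.
move=> fE ca cb; pose L v : R := a x * v.1 + b x * v.2.
have linL : linear L by move=> k u v; rewrite /L /= /GRing.scale /=; ring.
pose isL := GRing.isLinear.Build _ _ _ _ _ linL.
pose LL : {linear (R * R)%type -> R} := HB.pack L isL.
have cL : continuous LL.
  move=> v; rewrite /LL /= /L; apply: cvgD; apply: cvgM; try exact: cvg_cst.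
    exact: cvg_fst.
  exact: cvg_snd.
apply: (is_diff_epsilon cL) => e e0; have e20 : 0 < e / 2%:R by lra.
have /cvgrPdist_le/(_ _ e20) ae := ca; have /cvgrPdist_le/(_ _ e20) be := cb.
have : \forall y \near x, `|f y - (f x + L (y - x))| <= e * `|y - x|.
  apply: filterS3 fE ae be => y fy aye bye; rewrite opprD addrA fy /L /=.
  have -> : a y * (y.1 - x.1) + b y * (y.2 - x.2) -
      (a x * (y.1 - x.1) + b x * (y.2 - x.2)) =
      - ((a x - a y) * (y - x).1 + (b x - b y) * (y - x).2) by move=> /=; ring.
  rewrite normrN (le_trans (ler_normD _ _)) // !normrM.
  have /andP[y1 y2] : (`|(y - x).1| <= `|y - x|) && (`|(y - x).2| <= `|y - x|).
    by rewrite -prod_norm_le.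
  have -> : e * `|y - x| = e / 2%:R * `|y - x| + e / 2%:R * `|y - x| by lra.
  by rewrite lerD // ler_pM.
rewrite (near_shift 0) /= => shifted; apply: filterS shifted => h /=.
by rewrite subr0 addrK.
Qed.

Section Composition.
Variables (R : realType) (V : normedModType R).
Implicit Types (g : V -> R) (P : mpoly 2 R).

Lemma generated_peval (S : set (V -> R)) g1 g2 P :
  generated S g1 -> generated S g2 ->
  generated S (fun w => peval P (g1 w, g2 w)).
Proof.
move=> Sg1 Sg2; elim/mpoly_ring_ind: P => [c|i|P Q SP SQ|P Q SP SQ].
- under eq_fun do rewrite pevalC; exact: generated_cst.
- by under eq_fun do rewrite pevalX; case: i => [[|[|//]] lt_i].
- under eq_fun do rewrite pevalD; exact: generatedD.
- under eq_fun do rewrite pevalM; exact: generatedM.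
Qed.

Lemma derive_peval g1 g2 P x v :
  differentiable g1 x -> differentiable g2 x ->
  differentiable (fun w => peval P (g1 w, g2 w)) x /\
  'D_v (fun w => peval P (g1 w, g2 w)) x =
  peval (mderiv ord0 P) (g1 x, g2 x) * 'D_v g1 x +
  peval (mderiv ord_max P) (g1 x, g2 x) * 'D_v g2 x.
Proof.
move=> d1 d2.
have der g : differentiable g x -> derivable g x v by exact: diff_derivable.
elim/mpoly_ring_ind: P => [c|i|P Q [dP DP] [dQ DQ]|P Q [dP DP] [dQ DQ]].
- under eq_fun do rewrite pevalC; rewrite !mderivC -(mpolyC0 2 R) !pevalC.
  by rewrite derive_cst !mul0r addr0; split=> //; exact: differentiable_cst.
- rewrite !mderiv_mpolyXU -!mpolyC_nat !pevalC.
  under eq_fun do rewrite pevalX; case: i => [[|[|//]] lt_i].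
  + by split; rewrite // mul1r mul0r addr0.
  + by split; rewrite // mul1r mul0r add0r.
- under eq_fun do rewrite pevalD; rewrite !mderivD !pevalD.
  split; first exact: differentiableD.
  by rewrite deriveD ?DP ?DQ; try exact: der; ring.
- under eq_fun do rewrite pevalM; rewrite !mderivM !pevalD !pevalM.
  split; first exact: differentiableM.
  by rewrite deriveM ?DP ?DQ /GRing.scale /=; try exact: der; ring.
Qed.

End Composition.

Lemma continuous_lincomb (R : realType) (T : topologicalType) (k l m : R)
    (u v : T -> R) :
  continuous u -> continuous v -> continuous (fun z => (k * u z - l * v z) / m).
Proof.
move=> cu cv z; apply: cvgM; last exact: cvg_cst.
by apply: cvgB; apply: cvgM;
  [exact: cvg_cst|exact: cu|exact: cvg_cst|exact: cv].
Qed.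

Lemma continuous_pair (T U V : topologicalType) (f : T -> U) (g : T -> V) :
  continuous f -> continuous g -> continuous (fun x => (f x, g x)).
Proof.
move=> cf cg x.
exact: (@cvg_pair _ _ _ _ (nbhs (f x)) (nbhs (g x)) _ _ _ f g (cf x) (cg x)).
Qed.

(** * Local inversion of polynomial maps of the plane *)

Section LocalInversion.
Variables (R : realType) (P Q : mpoly 2 R).

Let F : R * R -> R * R := poly_map P Q.
Let J : mpoly 2 R := jac_det P Q.

Lemma smooth_poly_map (U : set (R * R)) : open U -> smooth_on U (poly_map P Q).
Proof.
move=> oU; pose S : set (R * R -> R) := [set fst; snd].
have dfst x : is_diff x (fst : R * R -> R) (fun v => 1 * v.1 + 0 * v.2).
  apply: (is_diff_slopes (a := cst 1) (b := cst 0)); try exact: cvg_cst.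
  by near=> y; rewrite mul1r mul0r addr0.
have dsnd x : is_diff x (snd : R * R -> R) (fun v => 0 * v.1 + 1 * v.2).
  apply: (is_diff_slopes (a := cst 0) (b := cst 1)); try exact: cvg_cst.
  by near=> y; rewrite mul1r mul0r add0r.
have Speval T : generated S (peval T).
  rewrite (_ : peval T = fun w => peval T (w.1, w.2)); last first.
    by apply/funext => -[].
  by apply: generated_peval; apply: generated_gen; [left|right].
apply: (smooth_on_generated_pair oU (S := S)) (Speval P) (Speval Q).
- by move=> _ [->|->] x _; exact: ex_diff.
- move=> _ [->|->] v.
    exists (cst v.1) => [|x _]; first exact: generated_cst.
    by rewrite deriveE // diff_val mul1r mul0r addr0.
  exists (cst v.2) => [|x _]; first exact: generated_cst.
  by rewrite deriveE // diff_val mul1r mul0r add0r.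
Unshelve. all: by end_near. Qed.

(** Subtracting [F (g w0) = w0] from [F (g w) = w] and writing both components
    of the difference with slopes gives a 2 x 2 linear system for [g w - g w0]
    whose matrix tends to the Jacobian matrix as [w] tends to [w0]; Cramer's
    rule then exhibits slopes of [g] that are continuous at [w0]. *)
Lemma is_diff_inverse (B : set (R * R)) (g : R * R -> R * R) w0 :
    open B -> (forall w, B w -> F (g w) = w) -> B w0 ->
    {for w0, continuous g} -> peval J (g w0) != 0 ->
  is_diff w0 (fun w => (g w).1) (fun v =>
    peval (mderiv ord_max Q) (g w0) / peval J (g w0) * v.1
    + - peval (mderiv ord_max P) (g w0) / peval J (g w0) * v.2) /\
  is_diff w0 (fun w => (g w).2) (fun v =>
    - peval (mderiv ord0 Q) (g w0) / peval J (g w0) * v.1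
    + peval (mderiv ord0 P) (g w0) / peval J (g w0) * v.2).
Proof.
move=> oB Fg Bw0 cg J0.
have [A1 [B1 [cA1 cB1 PE PA PB]]] := exists_slopes P.
have [A2 [B2 [cA2 cB2 QE QA QB]]] := exists_slopes Q.
pose D zw := A1 zw * B2 zw - B1 zw * A2 zw.
have cD : continuous D.
  move=> zw; apply: cvgB; apply: cvgM;
    [exact: cA1|exact: cB2|exact: cB1|exact: cA2].
have DJ z : D (z, z) = peval J z by rewrite peval_jac_det /D PA PB QA QB.
have cpair : {for w0, continuous (fun w => (g w, g w0))}.
  exact: (@cvg_pair _ _ _ _ (nbhs (g w0)) (nbhs (g w0)) _ _ _ g (cst (g w0))
            cg (cvg_cst _)).
have cgk (k : (R * R) * (R * R) -> R) : continuous k ->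
    {for w0, continuous (fun w => k (g w, g w0))}.
  by move=> ck; exact: (continuous_comp cpair (ck _)).
have D0 : D (g w0, g w0) != 0 by rewrite DJ.
have cquot (k : (R * R) * (R * R) -> R) : continuous k ->
    {for w0, continuous (fun w => k (g w, g w0) / D (g w, g w0))}.
  by move=> ck; apply: cvgM; [exact: cgk|apply: cvgV; [exact: D0|exact: cgk]].
have gE : \forall w \near w0,
    (g w).1 - (g w0).1 = B2 (g w, g w0) / D (g w, g w0) * (w.1 - w0.1)
                       + - B1 (g w, g w0) / D (g w, g w0) * (w.2 - w0.2) /\
    (g w).2 - (g w0).2 = - A2 (g w, g w0) / D (g w, g w0) * (w.1 - w0.1)
                       + A1 (g w, g w0) / D (g w, g w0) * (w.2 - w0.2).
  have Bnear : \forall w \near w0, B w by exact: open_nbhs_nbhs.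
  have Dnear : \forall w \near w0, D (g w, g w0) != 0.
    exact: cvgr_neq0 (cgk D cD) D0.
  apply: filterS2 Bnear Dnear => w Bw.
  have -> : w.1 - w0.1 = peval P (g w) - peval P (g w0).
    by rewrite -{1}(Fg _ Bw) -{1}(Fg _ Bw0).
  have -> : w.2 - w0.2 = peval Q (g w) - peval Q (g w0).
    by rewrite -{1}(Fg _ Bw) -{1}(Fg _ Bw0).
  by rewrite PE QE /D /= => Dw0; split; field.
rewrite -!DJ -PA -PB -QA -QB; split.
- apply: (is_diff_slopes (a := fun w => B2 (g w, g w0) / D (g w, g w0))
                         (b := fun w => - B1 (g w, g w0) / D (g w, g w0))).
  + by apply: filterS gE => w [].
  + exact: cquot.
  + by apply: (cquot (fun zw => - B1 zw)) => zw; apply: cvgN; exact: cB1.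
- apply: (is_diff_slopes (a := fun w => - A2 (g w, g w0) / D (g w, g w0))
                         (b := fun w => A1 (g w, g w0) / D (g w, g w0))).
  + by apply: filterS gE => w [].
  + by apply: (cquot (fun zw => - A2 zw)) => zw; apply: cvgN; exact: cA2.
  + exact: cquot.
Qed.

(** The first derivatives of [g] are polynomials in the two components of [g]
    and in [1 / J \o g].  These three functions thus generate an algebra that
    is stable under directional derivatives: the third one differentiates to
    [- (1 / J \o g) ^+ 2] times a derivative of [J \o g], and the chain rule
    expresses the latter in the same generators. *)
Lemma smooth_inverse (B : set (R * R)) (g : R * R -> R * R) :
    open B -> (forall w, B w -> F (g w) = w) ->
    (forall w, B w -> {for w, continuous g}) ->
    (forall w, B w -> peval J (g w) != 0) ->
  smooth_on B g.
Proof.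
move=> oB Fg cg J0.
pose g1 w := (g w).1; pose g2 w := (g w).2; pose j w := (peval J (g w))^-1.
have gE : g = fun w => (g1 w, g2 w).
  by apply/funext => w; rewrite /g1 /g2; case: (g w).
have dg w (Bw : B w) := is_diff_inverse oB Fg Bw (cg w Bw) (J0 w Bw).
have diff1 w : B w -> differentiable g1 w.
  by move=> Bw; have [d1 _] := dg w Bw; exact: ex_diff.
have diff2 w : B w -> differentiable g2 w.
  by move=> Bw; have [_ d2] := dg w Bw; exact: ex_diff.
pose S : set (R * R -> R) := [set g1; g2; j].
have Sg1 : generated S g1 by apply: generated_gen; left; left.
have Sg2 : generated S g2 by apply: generated_gen; left; right.
have Sj : generated S j by apply: generated_gen; right.
pose peg T w := peval T (g w).
have pegE T : peg T = fun w => peval T (g1 w, g2 w) by rewrite /peg gE.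
have Speg T : generated S (peg T) by rewrite pegE; exact: generated_peval.
have Dpeg T v w : B w -> differentiable (peg T) w /\
    'D_v (peg T) w =
    peg (mderiv ord0 T) w * 'D_v g1 w + peg (mderiv ord_max T) w * 'D_v g2 w.
  move=> Bw; rewrite !pegE.
  exact: derive_peval (diff1 w Bw) (diff2 w Bw).
pose e1 (v : R * R) := cst v.1 * (peg (mderiv ord_max Q) * j)
                     + cst (- v.2) * (peg (mderiv ord_max P) * j).
pose e2 (v : R * R) := cst (- v.1) * (peg (mderiv ord0 Q) * j)
                     + cst v.2 * (peg (mderiv ord0 P) * j).
have Se1 v : generated S (e1 v).
  by apply: generatedD; apply: generatedM;
    first [exact: generated_cst|exact: generatedM].
have Se2 v : generated S (e2 v).
  by apply: generatedD; apply: generatedM;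
    first [exact: generated_cst|exact: generatedM].
have De1 v w : B w -> 'D_v g1 w = e1 v w.
  move=> Bw; have [d1 _] := dg w Bw.
  by rewrite deriveE // diff_val /e1 /peg /j !fctE; ring.
have De2 v w : B w -> 'D_v g2 w = e2 v w.
  move=> Bw; have [_ d2] := dg w Bw.
  by rewrite deriveE // diff_val /e2 /peg /j !fctE; ring.
rewrite gE; apply: (smooth_on_generated_pair oB (S := S)) Sg1 Sg2.
- move=> _ [[->|->]|->] w Bw; [exact: diff1|exact: diff2|].
  apply: differentiableV; last exact: J0.
  by have [] := Dpeg J 0 w Bw.
- move=> _ [[->|->]|->] v.
  + by exists (e1 v) => // w; exact: De1.
  + by exists (e2 v) => // w; exact: De2.
  + exists (cst (-1) * (j * j) *
        (peg (mderiv ord0 J) * e1 v + peg (mderiv ord_max J) * e2 v)).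
      apply: generatedM; last by apply: generatedD; exact: generatedM.
      by apply: generatedM; [exact: generated_cst|exact: generatedM].
    move=> w Bw.
    have [dJ DJ] := Dpeg J v w Bw.
    rewrite deriveV; [|exact: J0|exact: diff_derivable].
    rewrite DJ De1 // De2 // /GRing.scale /= -exprVn expr2.
    by rewrite !fctE /j; ring.
Qed.

(** [L] is the inverse of the Jacobian matrix at [a]. The slope matrix of
    [L \o F] is continuous and equals the identity at [(a, a)], so its entries
    stay within 1/4 of those of the identity on a ball around [a]; with two
    entries per row this gives the factor 1/2 for the max norm of the plane. *)
Lemma poly_map_near_id a : peval J a != 0 ->
  exists (A : set (R * R)) (L : R * R -> R * R),
    [/\ open A, A a, continuous L, injective L &
        (forall z, A z -> peval J z != 0) /\
        (forall z w, A z -> A w ->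
           `|L (F z) - L (F w) - (z - w)| <= `|z - w| / 2%:R)].
Proof.
move=> Ja0.
have [A1 [B1 [cA1 cB1 PE PA PB]]] := exists_slopes P.
have [A2 [B2 [cA2 cB2 QE QA QB]]] := exists_slopes Q.
set aa := (a, a); pose d := peval J a.
have dE : d = A1 aa * B2 aa - B1 aa * A2 aa.
  by rewrite /d peval_jac_det PA PB QA QB.
have d0 : A1 aa * B2 aa - B1 aa * A2 aa != 0 by rewrite -dE.
pose L (w : R * R) : R * R := ((B2 aa * w.1 - B1 aa * w.2) / d,
                               (A1 aa * w.2 - A2 aa * w.1) / d).
pose M (z : R * R) : R * R := (A1 aa * z.1 + B1 aa * z.2,
                               A2 aa * z.1 + B2 aa * z.2).
have LK : cancel L M.
  by move=> [w1 w2]; rewrite /L /M dE /=; congr pair; field.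
have LB w w' : L w - L w' = L (w - w').
  by rewrite /L /=; congr pair => /=; ring.
have cL : continuous L.
  apply: continuous_pair; apply: continuous_lincomb => z.
  - exact: cvg_fst.
  - exact: cvg_snd.
  - exact: cvg_snd.
  - exact: cvg_fst.
pose c11 zw := (B2 aa * A1 zw - B1 aa * A2 zw) / d - 1.
pose c12 zw := (B2 aa * B1 zw - B1 aa * B2 zw) / d.
pose c21 zw := (A1 aa * A2 zw - A2 aa * A1 zw) / d.
pose c22 zw := (A1 aa * B2 zw - A2 aa * B1 zw) / d - 1.
have LFE z w : L (F z) - L (F w) - (z - w) =
    (c11 (z, w) * (z - w).1 + c12 (z, w) * (z - w).2,
     c21 (z, w) * (z - w).1 + c22 (z, w) * (z - w).2).
  rewrite LB /L /F /poly_map /= -![meval _ _]/(peval _ _) PE QE.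
  by rewrite /c11 /c12 /c21 /c22; congr pair => /=; ring.
have small (c : (R * R) * (R * R) -> R) : continuous c -> c aa = 0 ->
    \forall zw \near aa, `|c zw| <= 4%:R^-1.
  move=> /(_ aa) cc caa.
  have e0 : 0 < 4%:R^-1 :> R by rewrite invr_gt0 ltr0n.
  have /cvgrPdist_le/(_ _ e0) := cc; rewrite caa; apply: filterS => zw.
  by rewrite sub0r normrN.
have n11 : \forall zw \near aa, `|c11 zw| <= 4%:R^-1.
  apply: small => [zw|]; last by rewrite /c11 dE; field.
  by apply: cvgB; [exact: continuous_lincomb|exact: cvg_cst].
have n22 : \forall zw \near aa, `|c22 zw| <= 4%:R^-1.
  apply: small => [zw|]; last by rewrite /c22 dE; field.
  by apply: cvgB; [exact: continuous_lincomb|exact: cvg_cst].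
have n12 : \forall zw \near aa, `|c12 zw| <= 4%:R^-1.
  apply: small; first exact: continuous_lincomb.
  by rewrite /c12 (mulrC (B2 aa)) subrr mul0r.
have n21 : \forall zw \near aa, `|c21 zw| <= 4%:R^-1.
  apply: small; first exact: continuous_lincomb.
  by rewrite /c21 (mulrC (A1 aa)) subrr mul0r.
have nJ : \forall zw \near aa, peval J zw.1 != 0.
  have cJ : {for aa, continuous (fun zw => peval J zw.1)}.
    apply: (continuous_comp (f := fst)); first exact: cvg_fst.
    exact: continuous_peval.
  exact: cvgr_neq0 cJ Ja0.
have : \forall zw \near aa, [/\ peval J zw.1 != 0, `|c11 zw| <= 4%:R^-1,
    `|c12 zw| <= 4%:R^-1, `|c21 zw| <= 4%:R^-1 & `|c22 zw| <= 4%:R^-1].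
  by near=> zw; split; near: zw.
move=> /nbhs_ballP[r r0 rP]; exists (ball a r), L; split.
- exact: ball_open.
- exact: ballxx.
- exact: cL.
- exact: can_inj LK.
split=> [z az|z w az aw]; first by have [] := rP (z, a) (conj az (ballxx a r0)).
have [_ h11 h12 h21 h22] := rP (z, w) (conj az aw).
have /andP[z1 z2] : (`|(z - w).1| <= `|z - w|) && (`|(z - w).2| <= `|z - w|).
  by rewrite -prod_norm_le.
have row (k l : R) : `|k| <= 4%:R^-1 -> `|l| <= 4%:R^-1 ->
    `|k * (z - w).1 + l * (z - w).2| <= `|z - w| / 2%:R.
  move=> hk hl; rewrite (le_trans (ler_normD _ _)) // !normrM.
  have -> : `|z - w| / 2%:R = 4%:R^-1 * `|z - w| + 4%:R^-1 * `|z - w| by lra.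
  by rewrite lerD // ler_pM.
by rewrite LFE prod_norm_le /= !row.
Unshelve. all: by end_near. Qed.

Theorem poly_map_local_diffeo_at a :
  peval J a != 0 -> local_diffeo_at (poly_map P Q) a.
Proof.
move=> /poly_map_near_id[A [L [oA Aa cL injL [J0 near_id]]]].
have expand := near_id_expanding (f := L \o F) near_id.
have oLFA : open ((L \o F) @` A).
  apply: (open_image_near_id oA near_id) => z _.
  apply: continuous_comp; last exact: cL.
  by apply: continuous_pair; exact: continuous_peval.
(* this preimage is the image of A under F, because L is injective *)
pose B : set (R * R) := L @^-1` ((L \o F) @` A).
have oB : open B by apply: open_comp => // z _; exact: cL.
have AB z : A z -> B (F z) by exists z.
have BA w : B w -> exists2 z, A z & F z = w.
  by move=> [z Az /injL Fzw]; exists z.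
have [g gP] : {g : R * R -> R * R & forall w, B w -> A (g w) /\ F (g w) = w}.
  apply: (choice (P := fun w z => B w -> A z /\ F z = w)) => w.
  have [/BA[z Az Fz]|nB] := pselect (B w); first by exists z.
  by exists w.
have gA w : B w -> A (g w) by move=> /gP[].
have Fg w : B w -> F (g w) = w by move=> /gP[].
have gF z : A z -> g (F z) = z.
  move=> Az; have Bz := AB _ Az; have := expand _ _ (gA _ Bz) Az.
  rewrite /= Fg // subrr normr0 mulr0 normr_le0 subr_eq0.
  by move=> /eqP.
have cg w0 : B w0 -> {for w0, continuous g}.
  move=> Bw0; apply/cvgrPdist_le => e e0; have e20 : 0 < e / 2%:R by lra.
  have /cvgrPdist_le/(_ _ e20) Le := cL w0.
  have Bnear : \forall w \near w0, B w by exact: open_nbhs_nbhs.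
  apply: filterS2 Bnear Le => w Bw Lw.
  by have := expand _ _ (gA _ Bw0) (gA _ Bw); rewrite /= !Fg //; lra.
exists A, B, g; split; last split.
- split=> //; split=> [z /AB//|z w|w /BA[z Az <-]]; last by exists z.
  move=> /set_mem Az /set_mem Aw Fzw.
  by rewrite -(gF _ Az) -[RHS](gF _ Aw) /F Fzw.
- exact: smooth_poly_map.
- by apply: smooth_inverse => // w Bw; apply: J0; exact: gA.
Qed.

End LocalInversion.

(** * The Jacobian determinant of the map *)

Section Jacobian.
Variable R : realType.

Let t := t_poly R.
Let h := h_poly R.
Let f := f_poly R.
Let s := hf_quotient R.

Let dxx : mderiv ord0 (x_poly R) = 1 := mderiv_mpolyXU _ _ _.
Let dyx : mderiv ord_max (x_poly R) = 0 := mderiv_mpolyXU _ _ _.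
Let dxy : mderiv ord0 (y_poly R) = 0 := mderiv_mpolyXU _ _ _.
Let dyy : mderiv ord_max (y_poly R) = 1 := mderiv_mpolyXU _ _ _.
Let d1 i : mderiv i (1 : mpoly 2 R) = 0.
Proof. exact: mderivC. Qed.
Let dn i n : mderiv i (n%:R : mpoly 2 R) = 0.
Proof. by rewrite mderivMn d1 mul0rn. Qed.
Let mderiv_xyE := (mderivD, mderivN, mderivM, dxx, dyx, dxy, dyy, d1, dn).

Lemma jac_det_fh : jac_det f h = - f.
Proof.
rewrite /jac_det /f /h /f_poly /h_poly /t_poly !expr2 !mderiv_xyE; ring.
Qed.

Lemma jac_det_sh : jac_det s h = s.
Proof.
rewrite /jac_det /s /hf_quotient /h /h_poly /t_poly !expr2 !mderiv_xyE; ring.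
Qed.

Lemma jac_det_fs : jac_det f s = - (3%:R * h ^+ 2 + 2%:R * h).
Proof.
rewrite /jac_det /s /hf_quotient /f /h /f_poly /h_poly /t_poly !expr2.
rewrite !mderiv_xyE; ring.
Qed.

(** As [p] and [q] are polynomials in [f], [h] and [s], the chain rule reduces
    their Jacobian determinant to those of the pairs among [f], [h] and [s],
    and so to a polynomial in [f], [h] and [s].  It is a quadratic form in
    [s], [f], [h], [h ^+ 2] that is determined up to multiples of
    [f * s - h ^+ 3 - h ^+ 2]; adding [-4] times this relation makes it
    positive semidefinite. *)
Lemma jac_det_pq : jac_det (p_poly R) (q_poly R) =
  2%:R * (s - f + h + 2%:R * h ^+ 2) ^+ 2 + 2%:R * (h + h ^+ 2 - f) ^+ 2
  + f ^+ 2.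
Proof.
rewrite /p_poly /q_poly -/f -/h -/s; set c := mpolyC 2 _.
have c2 : c *+ 2 = 3%:R.
  by rewrite -mpolyCMn -[RHS]mpolyC_nat; congr mpolyC; field.
have dc i : mderiv i c = 0 by rewrite mderivC.
(* the coefficients are dq/dh - dq/df and dq/ds, where p = f + h *)
transitivity
  ((12%:R * h ^+ 2 - 4%:R * h * s + c *+ 2 * h - 5%:R * f + 5%:R * h)
   * jac_det f h
   - (2%:R * s + 2%:R * h ^+ 2) * (jac_det f s - jac_det s h)).
  by rewrite /jac_det !exprS !expr0 !mulr1 !mderiv_xyE !dc; ring.
rewrite c2 jac_det_fh jac_det_sh jac_det_fs.
have fs : f * s = h ^+ 3 + h ^+ 2 by rewrite -hf_quotientE.
by ring: fs.
Qed.

(** If the three squares vanish then [f = 0], [h * (h + 1) = 0] and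
    [s = - h - 2 * h ^+ 2].  For [h = 0] this gives [s = 0] and [t = h - s = 0],
    so that [f = y] vanishes and [t = x * y - 1] is also [-1]; for [h = -1] it
    gives [s = -1], hence [t = 0], and [h] vanishes as a multiple of [t]. *)
Lemma jac_det_pq_neq0 z : peval (jac_det (p_poly R) (q_poly R)) z != 0.
Proof.
apply/eqP; rewrite jac_det_pq.
have squaresE F H S : peval (2%:R * (S - F + H + 2%:R * H ^+ 2) ^+ 2
     + 2%:R * (H + H ^+ 2 - F) ^+ 2 + F ^+ 2) z
   = 2%:R * (peval S z - peval F z + peval H z + 2%:R * peval H z ^+ 2) ^+ 2
     + 2%:R * (peval H z + peval H z ^+ 2 - peval F z) ^+ 2 + peval F z ^+ 2.
  by rewrite /peval !(mevalD, mevalN, mevalM, meval1).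
rewrite squaresE.
set x := z.1; set y := z.2; set T := x * y - 1.
have xE : peval (x_poly R) z = x := pevalX _ _.
have yE : peval (y_poly R) z = y := pevalX _ _.
have HE : peval h z = x * T ^+ 2 + T.
  by rewrite /T -xE -yE /peval !(mevalD, mevalN, mevalM, meval1).
have FE : peval f z = (x * T + 1) ^+ 2 * (T ^+ 2 + y).
  by rewrite /T -xE -yE /peval !(mevalD, mevalN, mevalM, meval1).
have SE : peval s z = x * T ^+ 2.
  rewrite -[RHS](addrK T) -HE /T -xE -yE /peval.
  by rewrite !(mevalD, mevalN, mevalM, meval1).
have TE : T = x * y - 1 by [].
rewrite {}SE; move: (peval f z) (peval h z) HE FE => F H HE FE squares0.
clearbody T.
have [S0 HF0 F0] : [/\ x * T ^+ 2 - F + H + 2%:R * H ^+ 2 = 0,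
                       H + H ^+ 2 - F = 0 & F = 0].
  set a := _ + 2%:R * H ^+ 2 in squares0 *; set b := H + _ - _ in squares0 *.
  have := sqr_ge0 a; have := sqr_ge0 b; have := sqr_ge0 F => F2 b2 a2.
  by split; apply/eqP; rewrite -sqrf_eq0; apply/eqP; lra.
have HH : H * (H + 1) = 0 by rewrite -HF0 F0; ring.
have Hne0 : H != 0.
  apply/eqP => H0; have T0 : T = 0 by rewrite H0 F0 in S0; lra.
  have y0 : y = 0 by move: FE; rewrite F0 T0; lra.
  by move: TE; rewrite T0 y0; lra.
have H1 : H = -1.
  by move/eqP: HH; rewrite mulf_eq0 (negbTE Hne0) /= addr_eq0 => /eqP.
have T0 : T = 0 by rewrite H1 F0 in S0 HE; lra.
by move: HE; rewrite H1 T0; lra.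
Qed.

End Jacobian.

(** * Two points with the same image *)

Lemma not_injective_pq (R : realType) :
  ~ injective (poly_map (p_poly R) (q_poly R)).
Proof.
move=> inj.
have pqE z : poly_map (p_poly R) (q_poly R) z =
  let t := z.1 * z.2 - 1 in let h := z.1 * t ^+ 2 + t in
  let f := (z.1 * t + 1) ^+ 2 * (t ^+ 2 + z.2) in let s := h - t in
  (f + h, - (s ^+ 2) - 2%:R * h ^+ 2 * s + 4%:R * h ^+ 3 +
     3%:R / 2%:R * h ^+ 2 - 5%:R * h * f).
  rewrite /poly_map; set v := tnth _.
  have ex : meval v (x_poly R) = z.1 by rewrite mevalXU.
  have ey : meval v (y_poly R) = z.2 by rewrite mevalXU.
  by rewrite /= -ex -ey !(mevalB, mevalD, mevalN, mevalM, meval1, mevalC).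
(* the points of the curve x * t + 1 = 0 with x = 1 and x = -1 *)
have /inj[/eqP] : poly_map (p_poly R) (q_poly R) (1, 0) =
                  poly_map (p_poly R) (q_poly R) (-1, -2%:R).
  by rewrite !pqE /=; congr pair; field.
by lra.
Qed.

(** * Degrees *)

Section TopTerm.
Variable R : realType.
Implicit Types (P Q : mpoly 2 R) (c d : R) (a b : nat).

Definition monomial c a b : mpoly 2 R :=
  mpolyC 2 c * (x_poly R ^+ a * y_poly R ^+ b).

(** For [c != 0] the monomial is the whole homogeneous part of top degree, since
    [msize] is one plus the degree.  The case [c = 0] is allowed, so that terms
    of lower degree and cancellations need no special treatment. *)
Definition top_term P c a b := (msize (P - monomial c a b) <= a + b)%N.

Lemma msizeD_leq P Q k :
  (msize P <= k -> msize Q <= k -> msize (P + Q) <= k)%N.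
Proof.
by move=> lP lQ; rewrite (leq_trans (mmeasureD_le _ _ _)) // geq_max lP.
Qed.

Lemma msizeM_leq P Q j k :
  (msize P <= j -> msize Q <= k.+1 -> msize (P * Q) <= j + k)%N.
Proof.
have [->|P0] := eqVneq P 0; first by rewrite mul0r msize0.
have [->|Q0] := eqVneq Q 0; first by rewrite mulr0 msize0.
by rewrite msizeM //; move: (msize P) (msize Q) => m n; lia.
Qed.

Lemma msizeN P : msize (- P) = msize P.
Proof. exact: mmeasureN. Qed.

Lemma msize_mpolyXU_exp i a :
  msize (mpolyX R (mnm1 i : multinom 2) ^+ a) = a.+1.
Proof. by rewrite mpolyXn msizeX mdegMn mdeg1 mul1n. Qed.

Lemma msize_monomial c a b : c != 0 -> msize (monomial c a b) = (a + b).+1.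
Proof.
move=> c0; rewrite /monomial mul_mpolyC msizeZ // msizeM ?msize_mpolyXU_exp //.
  by rewrite addnS.
all: by rewrite -msize_poly_eq0 msize_mpolyXU_exp.
Qed.

Lemma msize_monomial_leq c a b : (msize (monomial c a b) <= (a + b).+1)%N.
Proof.
have [->|c0] := eqVneq c 0; last by rewrite msize_monomial.
by rewrite /monomial mpolyC0 mul0r msize0.
Qed.

Lemma top_term_leq P c a b : top_term P c a b -> (msize P <= (a + b).+1)%N.
Proof.
move=> PT; rewrite -(subrK (monomial c a b) P).
by rewrite msizeD_leq ?msize_monomial_leq //; exact: leqW.
Qed.

Lemma top_term_msize P c a b : c != 0 -> top_term P c a b ->
  msize P = (a + b).+1.
Proof.
move=> c0 PT; apply/anti_leq; rewrite (top_term_leq PT) /= ltnNge.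
apply: contraL (ltnSn (a + b)) => lP; rewrite -leqNgt -(msize_monomial a b c0).
by rewrite -[monomial _ _ _](subKr P) msizeD_leq // msizeN.
Qed.

Lemma top_term_low P a b : (msize P <= a + b)%N -> top_term P 0 a b.
Proof. by rewrite /top_term /monomial mpolyC0 mul0r subr0. Qed.

Lemma top_termD P Q c d a b :
  top_term P c a b -> top_term Q d a b -> top_term (P + Q) (c + d) a b.
Proof.
rewrite /top_term /monomial mpolyCD mulrDl opprD addrACA; exact: msizeD_leq.
Qed.

Lemma top_termM P Q c d a b a' b' :
  top_term P c a b -> top_term Q d a' b' ->
  top_term (P * Q) (c * d) (a + a') (b + b').
Proof.
move=> PT QT; rewrite /top_term.
have -> : P * Q - monomial (c * d) (a + a') (b + b') =
    (P - monomial c a b) * Q + (Q - monomial d a' b') * monomial c a b.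
  rewrite /monomial mpolyCM !exprD; ring.
rewrite addnACA msizeD_leq //.
  by rewrite msizeM_leq // (top_term_leq QT).
by rewrite addnC msizeM_leq // msize_monomial_leq.
Qed.

Lemma top_termX P c a b k :
  top_term P c a b -> top_term (P ^+ k) (c ^+ k) (a * k) (b * k).
Proof.
move=> PT; elim: k => [|k IH]; last by rewrite !exprS !mulnS; exact: top_termM.
by rewrite !muln0 /top_term /monomial !expr0 mpolyC1 !mulr1 subrr msize0.
Qed.

Lemma top_termZ P c d a b : top_term P c a b ->
  top_term (mpolyC 2 d * P) (d * c) a b.
Proof.
move=> PT; have dT : top_term (mpolyC 2 d) d 0 0.
  by rewrite /top_term /monomial !expr0 !mulr1 subrr msize0.
exact: top_termM dT PT.
Qed.

Let x := x_poly R.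
Let y := y_poly R.
Let t := t_poly R.
Let h := h_poly R.
Let f := f_poly R.
Let s := hf_quotient R.

Let x_top : top_term x 1 1 0.
Proof.
by rewrite /top_term /monomial mpolyC1 mul1r mulr1 expr1 subrr msize0.
Qed.

Let t_top : top_term t 1 1 1.
Proof.
rewrite /top_term /monomial mpolyC1 mul1r !expr1 /t /t_poly addrC addKr.
by rewrite msizeN msize1.
Qed.

Let s_top : top_term s 1 3 2.
Proof.
have -> : s = x * t ^+ 2 by rewrite /s /hf_quotient /h_poly addrK.
by have := top_termM x_top (top_termX 2 t_top); rewrite expr1n mul1r.
Qed.

Let h_top : top_term h 1 3 2.
Proof.
have -> : h = s + t by rewrite /s /hf_quotient subrK.
rewrite -[1]addr0; apply: top_termD s_top _.
by apply: top_term_low; rewrite (leq_trans (top_term_leq t_top)).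
Qed.

Let f_top : top_term f 1 6 4.
Proof.
have xt1 : top_term (x * t + 1) 1 2 1.
  rewrite -[X in top_term _ X]addr0; apply: top_termD.
    by have := top_termM x_top t_top; rewrite mul1r.
  by apply: top_term_low; rewrite msize1.
have t2y : top_term (t ^+ 2 + y) 1 2 2.
  rewrite -[1]addr0; apply: top_termD.
    by have := top_termX 2 t_top; rewrite expr1n.
  by apply: top_term_low; rewrite msizeX mdeg1.
by have := top_termM (top_termX 2 xt1) t2y; rewrite expr1n mul1r.
Qed.

Lemma total_degree_p : total_degree (p_poly R) = 10.
Proof.
rewrite /total_degree (@top_term_msize _ (1 + 0) 6 4) ?addr0 ?oner_eq0 //.
rewrite -[X in top_term _ X](addr0 1); apply: top_termD f_top _.
by apply: top_term_low; rewrite (leq_trans (top_term_leq h_top)).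
Qed.

Lemma total_degree_q : total_degree (q_poly R) = 15.
Proof.
have -> : q_poly R = mpolyC 2 (-2%:R) * (h ^+ 2 * s) + mpolyC 2 4%:R * h ^+ 3
    + mpolyC 2 (-5%:R) * (h * f)
    + (mpolyC 2 (3%:R / 2%:R) * h ^+ 2 - s ^+ 2).
  rewrite /q_poly -/h -/f -/s !mpolyCN !mpolyC_nat; ring.
rewrite /total_degree (@top_term_msize _ (- 2%:R + 4%:R - 5%:R + 0) 9 6) //.
  apply/eqP; lra.
have h2 := top_termX 2 h_top; have h3 := top_termX 3 h_top.
have s2 := top_termX 2 s_top; rewrite !expr1n in h2 h3 s2.
apply: top_termD; [apply: top_termD; [apply: top_termD|]|].
- have := top_termZ (-2%:R) (top_termM h2 s_top); by rewrite !mulr1.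
- have := top_termZ 4%:R h3; by rewrite mulr1.
- have := top_termZ (-5%:R) (top_termM h_top f_top); by rewrite !mulr1.
apply: top_term_low; rewrite (@leq_trans 11) // msizeD_leq ?msizeN //.
  exact: top_term_leq (top_termZ _ h2).
exact: top_term_leq s2.
Qed.

End TopTerm.

Theorem corollary2p6 (R : realType) :
  [/\ local_diffeo (poly_map (p_poly R) (q_poly R)),
      ~ injective (poly_map (p_poly R) (q_poly R)),
      total_degree (p_poly R) = 10
    & total_degree (q_poly R) = 15].
Proof.
split.
- by move=> a; apply: poly_map_local_diffeo_at; exact: jac_det_pq_neq0.
- exact: not_injective_pq.
- exact: total_degree_p.
- exact: total_degree_q.
Qed.
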